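(* Let $k\ge 4$ be an even integer. Then there exists an intersecting family $\mathcal{F}\subset\binom{[2k]}{k}$ such that $$\mathcal{D}(\mathcal{F})=\bigcup_{j=0}^{k-1}\binom{[2k]}{j}.$$ In particular $\binom{[2k]}{k-1}\subset\mathcal{D}(\mathcal{F})$.
   Context: $[m]=\{1,2,\dots,m\}$. For a set $S$ and an integer $j\ge 0$, $\binom{S}{j}$ denotes the family of all $j$-element subsets of $S$. For a family $\mathcal{F}$ of sets, $\mathcal{D}(\mathcal{F})=\{F\setminus F' : F,F'\in\mathcal{F}\}$ (the family of difference sets). A family $\mathcal{F}$ is intersecting if $F\cap F'\neq\emptyset$ for all $F,F'\in\mathcal{F}$. *)

(* Defs.v *)
From mathcomp Require Import all_boot.
Set Implicit Arguments. Unset Strict Implicit. Unset Printing Implicit Defensive.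

(* Ground set [m] is modelled by 'I_m = {0,...,m-1}. *)

Definition diff_family (T : finType) (F : {set {set T}}) : {set {set T}} :=
  [set A :\: B | A in F, B in F].

Definition intersecting (T : finType) (F : {set {set T}}) : Prop :=
  forall A B, A \in F -> B \in F -> A :&: B != set0.

(* Main.v *)
Require Import Defs.
From mathcomp Require Import all_boot.
From mathcomp Require Import zify.

(** Selecting one [k]-set from every complementary pair of a [2k]-set amounts
    to a colouring [f] of the [k]-sets with [f (~: A) = ~~ f A], and the
    selected sets form an intersecting family.  Its differences are all sets of
    size [< k] as soon as no [(k-1)]-set has all its [k]-supersets of one
    colour.

    Fix [W] of size [k-1].  Colouring [A] by the parity of [#|A :\: W|] changes
    under complementation since [k+1] is odd, and the only monochromatic
    [(k-1)]-set is [W].  This is repaired by exchanging the colours on a small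
    family [N], closed under complements, containing [t0 |: W] for some [t0]
    and, for every [u] in [W], the set [t0 |: (g u |: W :\ u)] with [g]
    injective.  A member of [N] is determined by its trace on [W], and by its
    trace on the complement of [W], so the exchange creates no new
    monochromatic set. *)

(** * Bichromatic sets, and subsets and supersets of prescribed size *)

Definition bichromatic {T : finType} (f : pred {set T}) (S : {set T}) :=
  exists x y, [/\ x \notin S, y \notin S & f (x |: S) != f (y |: S)].

Lemma exists_subset_card {T : finType} (A : {set T}) (n : nat) :
  n <= #|A| -> exists2 B : {set T}, B \subset A & #|B| = n.
Proof.
move=> le_n; exists [set x in take n (enum A)].
  by apply/subsetP=> x; rewrite inE => /mem_take; rewrite mem_enum.
rewrite cardsE; move/card_uniqP: (take_uniq n (enum_uniq A)) => ->.
by rewrite size_takel // -cardE.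
Qed.

Lemma exists_superset_card {T : finType} (A : {set T}) (n : nat) :
  #|A| <= n <= #|T| -> exists2 B : {set T}, A \subset B & #|B| = n.
Proof.
move=> /andP[leA leT]; have cA := cardsC A.
have [|B sB cB] := exists_subset_card (~: A) (n - #|A|); first by lia.
exists (A :|: B); first exact: subsetUl.
rewrite cardsU disjoint_setI0 ?cards0; first by lia.
by rewrite disjoint_sym disjoints_subset.
Qed.

(** * From a self-complementary colouring to the difference family *)

Section SelfComplementaryColouring.

Context {T : finType} {k : nat} {f : pred {set T}}.
Hypotheses (k_gt0 : 0 < k) (cardT : #|T| = 2 * k).
Hypothesis fC : forall A : {set T}, #|A| = k -> f (~: A) = ~~ f A.
Hypothesis f_bi : forall S : {set T}, #|S| = k.-1 -> bichromatic f S.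

Definition colour_class := [set A : {set T} | (#|A| == k) && f A].

(** Disjoint [k]-sets in a [2k]-set are complementary, so [fC] gives them opposite colours. *)
Lemma colour_class_intersecting : intersecting colour_class.
Proof.
move=> A B; rewrite !inE => /andP[/eqP cA fA] /andP[/eqP cB fB].
apply/eqP => AB0; have AsB : A \subset ~: B by rewrite -disjoints_subset -setI_eq0 AB0.
have cBC := cardsC B; have := fC _ cB; rewrite fB.
suff -> : ~: B = A by rewrite fA.
by apply/esym/eqP; rewrite eqEcard AsB; lia.
Qed.

(** If [A] is the selected set, then [~: B] is selected too, and removing it from [A] leaves
    [A :&: B]. *)
Lemma setI_diff_colour_class (A B : {set T}) :
  #|A| = k -> #|B| = k -> f A != f B -> A :&: B \in diff_family colour_class.
Proof.
wlog fA : A B / f A => [hwlog cA cB neq | cA cB neq].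
  case fA: (f A); first by apply: hwlog.
  by rewrite setIC; apply: hwlog => //; [move: neq; rewrite fA; case: (f B) | rewrite eq_sym].
apply/imset2P; exists A (~: B); rewrite ?inE ?cA ?fA ?eqxx //.
- have cBC := cardsC B; rewrite fC //; move: neq; rewrite fA.
  by case: (f B) => // _; rewrite andbT; lia.
- by rewrite setDE setCK.
Qed.

Lemma diff_family_colour_class :
  diff_family colour_class = [set S : {set T} | #|S| < k].
Proof.
apply/setP => S; rewrite [RHS]inE; apply/idP/idP.
  case/imset2P => A B FA FB ->.
  have := colour_class_intersecting _ _ FA FB; rewrite -card_gt0.
  by move: FA; rewrite inE => /andP[/eqP cA _]; rewrite cardsD; lia.
move=> ltS; have [|S' sSS' cS'] := exists_superset_card S k.-1; first by lia.
have [x [y [xS' yS' neq]]] := f_bi _ cS'.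
have cx : #|x |: S'| = k by rewrite cardsU1 xS'; lia.
have cy : #|y |: S'| = k by rewrite cardsU1 yS'; lia.
(* The set [E] below needs [k - #|S|] points among possibly only [k.-1], so the empty [S] is treated
   apart. *)
have [S0 | Sn0] := eqVneq S set0.
  have cxC := cardsC (x |: S').
  have -> : S = (x |: S') :&: ~: (x |: S') by rewrite setICr.
  by apply: setI_diff_colour_class; rewrite ?fC //; [lia | case: (f _)].
have Spos : 0 < #|S| by rewrite card_gt0.
have cU : #|x |: (y |: S')| <= k.+1 by rewrite cardsU1 cy; case: (x \notin _).
have cUC := cardsC (x |: (y |: S')).
(* [S :|: E] meets both [x |: S'] and [y |: S'] exactly in [S], and has not the
   same colour as one of them. *)
have [|E sE cE] := exists_subset_card (~: (x |: (y |: S'))) (k - #|S|); first by lia.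
have notE z : z \in E -> [/\ z != x, z != y & z \notin S'].
  by move=> /(subsetP sE); rewrite !inE !negb_or => /and3P[].
have SE0 : S :&: E = set0.
  apply/setP => z; rewrite !inE; apply/negP => /andP[/(subsetP sSS') zS' /notE[_ _]].
  by rewrite zS'.
have cSE : #|S :|: E| = k by rewrite cardsU SE0 cards0; lia.
have meet z : z = x \/ z = y -> (z |: S') :&: (S :|: E) = S.
  move=> zxy; apply/setP => a; rewrite !inE.
  have [aS | /= aS] := boolP (a \in S); first by rewrite (subsetP sSS') ?orbT.
  apply/negP => /andP[aS' /notE[ax ay nS']]; move: aS'; rewrite (negPf nS') orbF.
  by case: zxy => ->; rewrite ?(negPf ax) ?(negPf ay).
have [eqx | neqx] := eqVneq (f (x |: S')) (f (S :|: E)).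
  rewrite -(meet y); last by right.
  by apply: setI_diff_colour_class => //; rewrite -eqx eq_sym.
by rewrite -(meet x); [apply: setI_diff_colour_class | left].
Qed.

End SelfComplementaryColouring.

(** * The parity colouring with colours exchanged on [N] *)

Definition exchanged_parity {T : finType} (W : {set T}) (N : {set {set T}}) :
  pred {set T} := fun A => odd #|A :\: W| (+) (A \in N).

Section Exchange.

Context {T : finType} {k : nat} {W : {set T}} {N : {set {set T}}}.
Hypotheses (k_gt0 : 0 < k) (k_even : ~~ odd k).
Hypotheses (cardT : #|T| = 2 * k) (cardW : #|W| = k.-1).
Hypothesis NC : forall A : {set T}, (~: A \in N) = (A \in N).

Lemma exchanged_parityC (A : {set T}) :
  exchanged_parity W N (~: A) = ~~ exchanged_parity W N A.
Proof.
rewrite /exchanged_parity NC -addNb; congr (_ (+) _).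
have : #|A :\: W| + #|~: A :\: W| = k.+1.
  have := cardsC W; rewrite -(cardsID A (~: W)) setIC -setDE.
  by rewrite [~: W :\: A]setDE setIC -setDE; lia.
by move=> /(congr1 odd); rewrite oddD /= k_even; case: odd; case: odd.
Qed.

Context {t0 : T}.
Hypothesis N_injI : {in N &, injective (fun A => A :&: W)}.
Hypothesis N_injD : {in N &, injective (fun A => A :\: W)}.
Hypothesis t0W : t0 \notin W.
Hypothesis N_t0W : t0 |: W \in N.
Hypothesis N_swap : forall w, w \in W ->
  exists2 t, t \notin t0 |: W & t |: (t0 |: W :\ w) \in N.

(** Adding a point outside [W] flips the parity, adding a point of [W] keeps it. All extensions of
    [S] of one kind share a trace, so at most one of each kind lies in [N]; two extensions of
    different kinds outside [N] have different colours. *)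
Lemma exchanged_parity_bichromatic (S : {set T}) :
  #|S| = k.-1 -> bichromatic (exchanged_parity W N) S.
Proof.
move=> cS; rewrite /bichromatic /exchanged_parity.
have cD x : x \notin S -> #|(x |: S) :\: W| = (x \notin W) + #|S :\: W|.
  move=> xS; rewrite setDUl; have [xW | xW] := boolP (x \in W).
    by rewrite (_ : [set x] :\: W = set0) ?set0U //; apply/eqP; rewrite setD_eq0 sub1set.
  rewrite (_ : [set x] :\: W = [set x]) ?cardsU1 ?inE ?(negPf xS) ?andbF //.
  by apply/setDidPl; rewrite disjoints1.
have trI x : x \notin W -> (x |: S) :&: W = S :&: W.
  by move=> xW; apply/setP => z; rewrite !inE; case: eqP => // ->; rewrite (negPf xW) !andbF.
have trD x : x \in W -> (x |: S) :\: W = S :\: W.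
  by move=> xW; apply/setP => z; rewrite !inE; case: eqP => // ->; rewrite xW.
have addI x y : x \notin S -> x |: S = y |: S -> x = y.
  move=> xS e; have : x \in y |: S by rewrite -e setU11.
  by rewrite !inE (negPf xS) orbF => /eqP.
(* [W :|: S] has at most [2 * k.-1] points. Two spare points are wanted because one of the two
   extensions may lie in [N]. *)
have [t [t' [tW t'W tS t'S tt']]] : exists t t', [/\ t \notin W, t' \notin W,
    t \notin S, t' \notin S & t != t'].
  have : 1 < #|~: (W :|: S)|.
    have := cardsC W; have := cardsC (W :|: S); rewrite cardsU => cWS cW.
    by lia.
  case/card_gt1P => t [t' []]; rewrite !inE !negb_or => /andP[tW tS] /andP[t'W t'S] tt'.
  by exists t, t'.
have {t t' tW t'W tS t'S tt'} [t [tW tS tN]] :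
    exists t, [/\ t \notin W, t \notin S & t |: S \notin N].
  have [tN | tN] := boolP (t |: S \in N); last by exists t.
  exists t'; split=> //; apply/negP => t'N.
  by case/eqP: tt'; apply: addI => //; apply: N_injI; rewrite // !trI.
(* If [S = W], all extensions have the same parity, and the exchange at [t0 |: W] supplies the
   second colour. *)
have [WS0 | [w]] := set_0Vmem (W :\: S).
  have eWS : W = S.
    by apply/eqP; rewrite eqEcard cS cardW leqnn andbT -setD_eq0 WS0.
  have t0S : t0 \notin S by rewrite -eWS.
  exists t0, t; rewrite !cD // (negPf tN) t0W tW -eWS N_t0W.
  by case: (odd _).
rewrite inE => /andP[wS wW].
have [wN | wN] := boolP (w |: S \in N); last first.
  exists t, w; rewrite !cD // tW wW (negPf tN) (negPf wN) /=.
  by case: (odd _).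
have [WS1 | [w']] := set_0Vmem (W :\: (w |: S)); last first.
  rewrite !inE negb_or -andbA => /and3P[w'w w'S w'W].
  have w'N : w' |: S \notin N.
    apply/negP => w'N; case/eqP: w'w; apply: addI => //.
    by apply: N_injD; rewrite // !trD.
  exists t, w'; rewrite !cD // tW w'W (negPf tN) (negPf w'N) /=.
  by case: (odd _).
(* Here [W \subset w |: S], so that [w |: S = t0 |: W]. *)
have WsS : W \subset w |: S by rewrite -setD_eq0 WS1.
have ewS : w |: S = t0 |: W.
  apply: N_injI => //.
  by rewrite setIC (setIidPl WsS) setIC (setIidPl _) // subsetUr.
have eS : S = t0 |: W :\ w.
  have w_t0 : t0 != w by apply: contraNneq t0W => ->.
  rewrite -[S](setU1K wS) ewS setDUl; congr (_ :|: _).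
  by apply/setDidPl; rewrite disjoints1 inE.
(* Both [s |: S] and [w |: S] lie in [N], so their opposite parities still give opposite colours. *)
have [s sW sN] := N_swap _ wW; move: sW; rewrite !inE negb_or => /andP[st0 sW].
have sS : s \notin S by rewrite eS !inE (negPf st0) (negPf sW) andbF.
rewrite -eS in sN; exists s, w; rewrite !cD // sW wW wN sN /=.
by case: (odd _).
Qed.

End Exchange.

(** * Construction of the exchanged family *)

Section SwapFamily.

Context {T : finType} {W : {set T}} {t0 : T} {g : T -> T}.
Hypotheses (W_gt2 : 2 < #|W|) (cW_gt4 : 4 < #|~: W|).
Hypotheses (t0W : t0 \notin W) (g_t0 : g t0 = t0).
Hypothesis gW : {in t0 |: W, forall u, g u \notin W}.
Hypothesis g_inj : {in t0 |: W &, injective g}.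

(* Because [g t0 = t0], the set [t0 |: W] is [swap t0]. *)
Definition swap u := g u |: (t0 |: W :\ u).

Definition swap_family :=
  [set A | (A \in swap @: (t0 |: W)) || (~: A \in swap @: (t0 |: W))].

Lemma swap_familyC (A : {set T}) : (~: A \in swap_family) = (A \in swap_family).
Proof. by rewrite !inE setCK orbC. Qed.

Lemma swapI u : u \in t0 |: W -> swap u :&: W = W :\ u.
Proof.
move=> /gW guW; apply/setP => z; rewrite !inE.
have [-> | _] := eqVneq z (g u); first by rewrite (negPf guW) !andbF.
by have [-> | _] := eqVneq z t0; rewrite ?(negPf t0W) ?andbF //= -andbA andbb.
Qed.

Lemma swapD u : u \in t0 |: W -> swap u :\: W = [set t0; g u].
Proof.
move=> /gW guW; apply/setP => z; rewrite !inE.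
have [-> | _] := eqVneq z (g u); first by rewrite guW orbT.
have [-> | _] := eqVneq z t0; first by rewrite t0W.
by case: (z \in W); rewrite ?andbF.
Qed.

Lemma swap_injI : {in t0 |: W &, forall u v, swap u :&: W = swap v :&: W -> u = v}.
Proof.
move=> u v uW vW; rewrite !swapI // => e.
wlog uW' : u v uW vW e / u \in W => [hwlog|].
  have [uW' | uW'] := boolP (u \in W); first exact: hwlog.
  have [vW' | vW'] := boolP (v \in W); first by apply/esym/hwlog.
  by move: uW vW; rewrite !inE (negPf uW') (negPf vW') !orbF => /eqP-> /eqP->.
apply/eqP; apply: contraT => uv.
by move/setP/(_ u): e; rewrite !inE eqxx uv uW'.
Qed.

Lemma swap_injD : {in t0 |: W &, forall u v, swap u :\: W = swap v :\: W -> u = v}.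
Proof.
move=> u v uW vW; rewrite !swapD // => e; apply: g_inj => //.
have: g u \in [set t0; g v] by rewrite -e set22.
have: g v \in [set t0; g u] by rewrite e set22.
rewrite !inE => /orP[/eqP gv | /eqP -> //] /orP[/eqP gu | /eqP -> //].
by rewrite gu gv.
Qed.

(** This bound and the next three tell a swap from the complement of a swap by the size of either
    trace, which settles the mixed cases of the injectivity proofs. *)
Lemma card_swapI u : u \in t0 |: W -> 1 < #|swap u :&: W|.
Proof. by move=> uW; rewrite swapI //; have := cardsD1 u W; case: (u \in W) => /=; lia. Qed.

Lemma card_swapD u : u \in t0 |: W -> #|swap u :\: W| <= 2.
Proof. by move=> uW; rewrite swapD // cards2; case: (_ != _). Qed.

Lemma card_setCswapI u : u \in t0 |: W -> #|~: swap u :&: W| <= 1.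
Proof.
move=> uW; rewrite setIC -setDE.
have := cardsID (swap u) W; rewrite setIC swapI // => e.
by have := cardsD1 u W; case: (u \in W) => /=; lia.
Qed.

Lemma card_setCswapD u : u \in t0 |: W -> 2 < #|~: swap u :\: W|.
Proof.
move=> uW; have := card_swapD u uW; have := cardsID (swap u) (~: W).
by rewrite setIC -!setDE [~: W :\: _]setDE setIC -setDE; lia.
Qed.

Lemma swap_family_injI : {in swap_family &, injective (fun A => A :&: W)}.
Proof.
move=> A B; rewrite !inE => /orP[] /imsetP[u uW eA] /orP[] /imsetP[v vW eB] /= e.
- by rewrite eA eB in e *; congr swap; apply: swap_injI.
- rewrite -[B]setCK eA eB in e.
  by have := card_swapI u uW; have := card_setCswapI v vW; rewrite e; lia.
- rewrite -[A]setCK eA eB in e.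
  by have := card_swapI v vW; have := card_setCswapI u uW; rewrite e; lia.
- apply: setC_inj; rewrite eA eB; congr swap; apply: swap_injI => //.
  rewrite -eA -eB; apply/setP => z; move/setP/(_ z): e; rewrite !inE.
  by case: (z \in W); rewrite ?andbF ?andbT // => ->.
Qed.

Lemma swap_family_injD : {in swap_family &, injective (fun A => A :\: W)}.
Proof.
move=> A B; rewrite !inE => /orP[] /imsetP[u uW eA] /orP[] /imsetP[v vW eB] /= e.
- by rewrite eA eB in e *; congr swap; apply: swap_injD.
- rewrite -[B]setCK eA eB in e.
  by have := card_swapD u uW; have := card_setCswapD v vW; rewrite e; lia.
- rewrite -[A]setCK eA eB in e.
  by have := card_swapD v vW; have := card_setCswapD u uW; rewrite e; lia.
- apply: setC_inj; rewrite eA eB; congr swap; apply: swap_injD => //.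
  rewrite -eA -eB; apply/setP => z; move/setP/(_ z): e; rewrite !inE.
  by case: (z \in W) => //= ->.
Qed.

Lemma swap_family_t0W : t0 |: W \in swap_family.
Proof.
rewrite inE; apply/orP; left; apply/imsetP; exists t0; rewrite ?setU11 //.
rewrite /swap g_t0 setUA setUid; congr (_ :|: _); apply/esym/setDidPl.
by rewrite disjoint_sym disjoints1.
Qed.

Lemma swap_family_swap w : w \in W ->
  exists2 t, t \notin t0 |: W & t |: (t0 |: W :\ w) \in swap_family.
Proof.
move=> wW; have wW' : w \in t0 |: W by rewrite setU1r.
exists (g w); last by rewrite inE (imset_f swap wW').
rewrite !inE negb_or gW // andbT; apply: contraNneq t0W => e.
by rewrite -(g_inj w t0) ?setU11 // e g_t0.
Qed.

End SwapFamily.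

(** * The concrete choice of [W], [t0] and [g] *)

Theorem theorem1 (k : nat) (hk : 4 <= k) (hev : ~~ odd k) :
  exists F : {set {set 'I_(2 * k)}},
    (forall A, A \in F -> #|A| = k) /\
    intersecting F /\
    diff_family F = [set S : {set 'I_(2 * k)} | #|S| < k].
Proof.
pose W := [set i : 'I_(2 * k) | i < k.-1].
have lt0 : k.-1 < 2 * k by lia.
pose t0 := Ordinal lt0.
(* The reflection of the ordinals around [t0] sends [W] outside of [W]. *)
pose g (i : 'I_(2 * k)) := insubd t0 (2 * k.-1 - i).
have cardW : #|W| = k.-1.
  have inj : injective (widen_ord (ltnW lt0)).
    by move=> i j /(congr1 val) /= e; apply: val_inj.
  rewrite -[RHS]card_ord -(card_imset _ inj); apply: eq_card => i.
  rewrite inE; apply/idP/imsetP => [ltik | [j _ ->]]; last exact: (ltn_ord j).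
  by exists (Ordinal ltik) => //; apply: val_inj.
(* Since [2 * k.-1 - i < 2 * k], the default of [insubd] is never reached; on [t0 |: W] the
   subtraction does not truncate, as [i <= k.-1] there. *)
have gE i : i \in t0 |: W -> g i = 2 * k.-1 - i :> nat.
  by move=> _; rewrite val_insubd; case: ifP => //; have := ltn_ord i; lia.
have le_t0 i : i \in t0 |: W -> i <= k.-1.
  by rewrite !inE => /orP[/eqP -> // | /ltnW].
have g_t0 : g t0 = t0 by apply: val_inj; rewrite /= gE ?setU11 //=; lia.
have t0W : t0 \notin W by rewrite inE ltnn.
have gW : {in t0 |: W, forall u, g u \notin W}.
  by move=> u uW; rewrite inE gE //; have := le_t0 _ uW; lia.
have g_inj : {in t0 |: W &, injective g}.
  move=> u v uW vW /(congr1 val) /=; rewrite !gE // => e; apply: val_inj => /=.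
  by have := le_t0 _ uW; have := le_t0 _ vW; lia.
have k_gt0 : 0 < k by lia.
have cardT : #|'I_(2 * k)| = 2 * k by rewrite card_ord.
(* Both size bounds amount to [4 <= k], as [W] and its complement have [k.-1] and [k.+1] points. *)
have W_gt2 : 2 < #|W| by rewrite cardW; lia.
have cW_gt4 : 4 < #|~: W| by have := cardsC W; rewrite cardW cardT; lia.
pose f := exchanged_parity W (@swap_family _ W t0 g).
have fC (A : {set 'I_(2 * k)}) : #|A| = k -> f (~: A) = ~~ f A.
  by move=> _; apply: (exchanged_parityC k_gt0) => //; exact: swap_familyC.
have f_bi (S : {set 'I_(2 * k)}) : #|S| = k.-1 -> bichromatic f S.
  apply: (exchanged_parity_bichromatic k_gt0 hev cardT cardW _ _ t0W) => //.
  - exact: swap_family_injI.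
  - exact: swap_family_injD.
  - exact: swap_family_t0W.
  - exact: swap_family_swap.
exists (@colour_class _ k f); split; first by move=> A; rewrite inE => /andP[/eqP].
split; first exact: colour_class_intersecting.
exact: diff_family_colour_class.
Qed.
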